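(* Let $G$ be a finite reflexive graph and $L$ a distributive lattice on $V(G)$ compatible with $G$. Then there exist integers $d\ge1$, $n_1,\dots,n_d\ge0$, a set $\mathcal{V}$ which is a union of vertex intervals of $\mathcal{P}=\prod_{i=1}^d\{0,1,\dots,n_i\}$ (product of chains with the componentwise order), a lattice isomorphism $\varphi$ from $L$ onto $\mathcal{P}\setminus\mathcal{V}$ (a sublattice of $\mathcal{P}$), and for each $i$ a reflexive proper interval graph $G_i$ on $\{0,\dots,n_i\}$ compatible with the chain $0<1<\dots<n_i$, such that $\varphi$ is a graph isomorphism from $G$ onto the subgraph of the categorical product $\prod_{i=1}^d G_i$ induced by $\mathcal{P}\setminus\mathcal{V}$.
   Context: A lattice $L$ on $V(G)$ is compatible with the reflexive graph $G$ if whenever $u\sim u'$ and $v\sim v'$ we have $u\wedge v\sim u'\wedge v'$ and $u\vee v\sim u'\vee v'$. A reflexive graph on $\{0,\dots,n\}$ is a proper interval graph (in min-max form) if $u'\le u\le v\le v'$ and $u'\sim v'$ imply $u\sim v$. The categorical product $\prod G_i$ has vertex set $\prod V(G_i)$ with $x\sim y$ iff $x_i\sim y_i$ in $G_i$ for all $i$. A vertex interval of $\mathcal{P}=\prod_{i=1}^d\{0,\dots,n_i\}$ is a set $\{x\in\mathcal{P}:\alpha\le x_i\text{ and }x_j\le\beta\}$ for some $i,j\in\{1,\dots,d\}$, $0\le\alpha\le n_i$, $0\le\beta\le n_j$. *)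

(* Defs.v *)
From HB Require Import structures.
From mathcomp Require Import all_boot all_order.

Set Implicit Arguments.
Unset Strict Implicit.
Unset Printing Implicit Defensive.

Import Order.TTheory.
Local Open Scope order_scope.

(* Graphs on a type T are given by their adjacency relation e : rel T, and
   reflexive graphs are those with e reflexive and symmetric. *)

Definition compatible (disp : Order.disp_t) (T : latticeType disp)
    (e : rel T) : Prop :=
  forall u u' v v' : T, e u u' -> e v v' ->
    e (u `&` v) (u' `&` v') /\ e (u `|` v) (u' `|` v').

(* The vertices 0, ..., m form the type 'I_m.+1, with its canonical order. *)
Definition proper_interval_graph (m : nat) (e : rel 'I_m.+1) : Prop :=
  [/\ reflexive e, symmetric e &
      forall u' u v v' : 'I_m.+1, u' <= u -> u <= v -> v <= v' ->
        e u' v' -> e u v].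

Definition chain_prod (d : nat) (n : 'I_d -> nat) : Type :=
  {dffun forall i : 'I_d, 'I_(n i).+1}.

HB.instance Definition _ (d : nat) (n : 'I_d -> nat) :=
  Finite.on (chain_prod n).

Section ChainProdLattice.
Variables (d : nat) (n : 'I_d -> nat).
Implicit Types x y z : chain_prod n.

Definition cp_le x y : bool := [forall i, x i <= y i].
Definition cp_meet x y : chain_prod n := [ffun i => x i `&` y i].
Definition cp_join x y : chain_prod n := [ffun i => x i `|` y i].

Fact cp_le_refl : reflexive cp_le.
Proof. by move=> x; apply/forallP => i. Qed.

Fact cp_le_anti : antisymmetric cp_le.
Proof.
move=> x y /andP[/forallP lexy /forallP leyx].
by apply/ffunP => i; apply: le_anti; rewrite lexy leyx.
Qed.

Fact cp_le_trans : transitive cp_le.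
Proof.
move=> y x z /forallP lexy /forallP leyz.
by apply/forallP => i; apply: le_trans (leyz i).
Qed.

HB.instance Definition _ :=
  Order.Le_isPOrder.Build (Order.Disp tt tt) (chain_prod n)
    cp_le_refl cp_le_anti cp_le_trans.

Fact cp_meetP x y z : (x <= cp_meet y z) = (x <= y) && (x <= z).
Proof.
apply/forallP/andP => [le_x|[/forallP lexy /forallP lexz] i]; last first.
  by rewrite ffunE lexI lexy lexz.
by split; apply/forallP => i; have:= le_x i; rewrite ffunE lexI => /andP[].
Qed.

Fact cp_joinP x y z : (cp_join x y <= z) = (x <= z) && (y <= z).
Proof.
apply/forallP/andP => [le_z|[/forallP lexz /forallP leyz] i]; last first.
  by rewrite ffunE leUx lexz leyz.
by split; apply/forallP => i; have:= le_z i; rewrite ffunE leUx => /andP[].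
Qed.

HB.instance Definition _ :=
  Order.POrder_MeetJoin_isLattice.Build (Order.Disp tt tt) (chain_prod n)
    cp_meetP cp_joinP.

End ChainProdLattice.

Definition vertex_interval (d : nat) (n : 'I_d -> nat) (i j : 'I_d)
    (alpha : 'I_(n i).+1) (beta : 'I_(n j).+1) : {set chain_prod n} :=
  [set x : chain_prod n | (alpha <= x i) && (x j <= beta)].

Definition is_vertex_interval (d : nat) (n : 'I_d -> nat)
    (A : {set chain_prod n}) : Prop :=
  exists (i j : 'I_d) (alpha : 'I_(n i).+1) (beta : 'I_(n j).+1),
    A = vertex_interval alpha beta.

(* The family F may be empty, so V = set0 is allowed. *)
Definition union_of_vertex_intervals (d : nat) (n : 'I_d -> nat)
    (V : {set chain_prod n}) : Prop :=
  exists2 F : {set {set chain_prod n}},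
    forall A, A \in F -> is_vertex_interval A & V = cover F.

Definition cat_prod (d : nat) (n : 'I_d -> nat)
    (G : forall i : 'I_d, rel 'I_(n i).+1) : rel (chain_prod n) :=
  fun x y => [forall i, G i (x i) (y i)].

Definition sublattice (disp : Order.disp_t) (T : latticeType disp)
    (S : {pred T}) : Prop :=
  Order.ClosedPredicates.meet_closed S /\ Order.ClosedPredicates.join_closed S.

(* f, with its codomain restricted to S, is a bijection T -> S *)
Definition bij_onto (T U : finType) (f : T -> U) (S : {set U}) : Prop :=
  injective f /\ [set f x | x : T] = S.

Definition lattice_iso_onto (disp disp' : Order.disp_t)
    (T : finLatticeType disp) (U : finLatticeType disp')
    (f : T -> U) (S : {set U}) : Prop :=
  [/\ bij_onto f S, Order.meet_morphism f & Order.join_morphism f].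

Definition graph_iso_onto_induced (T U : finType) (eT : rel T) (eU : rel U)
    (f : T -> U) (S : {set U}) : Prop :=
  bij_onto f S /\ {mono f : x y / eT x y >-> eU x y}.

(* Main.v *)
(** Let [F i] be a separating family of filters of a finite lattice.  An element
    [z] lies in a sublattice [S] as soon as, for all [i] and [j] with
    [z \in F i], some [s \in S] satisfies [s \in F i] and
    [s \in F j -> z \in F j].  This is applied twice.

    Applied to the adjacency relation [e], a sublattice of [T * T], it shows that
    [x] and [y] are non-adjacent only if there are prime filters [H \subset F]
    with one vertex in [H], the other outside [F], and no edge between [H] and
    the complement of [F].  The homomorphism [x |-> (x \in F) + (x \in H)] to the
    chain [0 < 1 < 2], equipped with the path [0 - 1 - 2], detects this non-edge.
    All factors of the product are therefore three-element chains, indexed by the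
    pairs [H \subset F], carrying the path or the complete graph.

    Applied to the image of a lattice homomorphism into a product of chains, it
    shows that the complement of this image is the union of the vertex intervals
    which avoid it. *)

Require Import Defs.
From mathcomp Require Import all_boot all_order.
From mathcomp Require Import zify.

Import Order.TTheory.

Section Interpolation.
Local Open Scope order_scope.

(** An element of [S] with the fewest lower bounds works: meeting it with some [x] not above it
    would lose a lower bound. *)
Lemma meet_closed_least (disp : Order.disp_t) (L : finLatticeType disp)
    (S : {pred L}) (x0 : L) :
  x0 \in S -> (forall x y, x \in S -> y \in S -> x `&` y \in S) ->
  exists2 m, m \in S & forall x, x \in S -> m <= x.
Proof.
move=> Sx0 SI.
case: (@arg_minnP _ x0 (mem S) (fun x => #|[set t | t <= x]|) Sx0) => m Sm minm.
exists m => // x Sx; have := minm _ (SI _ _ Sm Sx).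
apply: contraTT => nle_mx; rewrite -ltnNge; apply: proper_card.
apply/properP; split.
  by apply/subsetP => t; rewrite !inE lexI => /andP[].
by exists m; rewrite !inE ?lexx // lexI lexx.
Qed.

Lemma join_closed_greatest (disp : Order.disp_t) (L : finLatticeType disp)
    (S : {pred L}) (x0 : L) :
  x0 \in S -> (forall x y, x \in S -> y \in S -> x `|` y \in S) ->
  exists2 m, m \in S & forall x, x \in S -> x <= m.
Proof. exact: (@meet_closed_least _ L^d). Qed.

(** When [z \in F i], the least element of [S] in [F i] lies below [z]: any [F j] containing it
    contains the interpolating [s], hence [z]. The greatest element of [S] below [z] dominates all
    of these, so it lies in every such [F i] and equals [z]. *)
Lemma sublattice_interpolation (disp : Order.disp_t) (L : finLatticeType disp)
    (I : Type) (F : I -> {pred L}) (S : {pred L}) (z : L) (i0 : I) :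
  (forall i x y, (x `&` y \in F i) = (x \in F i) && (y \in F i)) ->
  (forall x y, (forall i, x \in F i -> y \in F i) -> x <= y) ->
  (forall x y, x \in S -> y \in S -> x `&` y \in S) ->
  (forall x y, x \in S -> y \in S -> x `|` y \in S) ->
  z \in F i0 ->
  (forall i j, z \in F i ->
     exists s, [/\ s \in S, s \in F i & s \in F j -> z \in F j]) ->
  z \in S.
Proof.
move=> FI Fsep SI SU Fz interp.
have Fup i x y : x <= y -> x \in F i -> y \in F i.
  by move=> /meet_idPl <-; rewrite FI => /andP[].
have below i : z \in F i -> exists u, [/\ u \in S, u \in F i & u <= z].
  move=> Fiz; have [s0 [Ss0 Fs0 _]] := interp i i Fiz.
  have [||u] := @meet_closed_least _ L [pred s in S | s \in F i] s0.
  - by rewrite inE Ss0.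
  - move=> x y; rewrite !inE => /andP[Sx Fx] /andP[Sy Fy].
    by rewrite SI //= FI Fx.
  rewrite inE => /andP[Su Fu] leu; exists u; split=> //.
  apply: Fsep => j Fju; have [s [Ss Fis]] := interp i j Fiz; apply.
  by apply: Fup Fju; apply: leu; rewrite inE Ss.
have [u0 [Su0 _ le_u0z]] := below i0 Fz.
have [||m] := @join_closed_greatest _ L [pred s in S | s <= z] u0.
- by rewrite inE Su0.
- move=> x y; rewrite !inE => /andP[Sx lex] /andP[Sy ley].
  by rewrite SU //= leUx lex.
rewrite inE => /andP[Sm le_mz] gem.
suff -> : z = m by [].
apply: le_anti; rewrite le_mz andbT; apply: Fsep => i /below[u [Su Fu le_uz]].
by apply: Fup Fu; apply: gem; rewrite inE Su.
Qed.

End Interpolation.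

Section PrimeFilters.
Local Open Scope order_scope.
Context {disp : Order.disp_t} {T : finDistrLatticeType disp}.
Implicit Types (x y : T) (F H : {set T}).

(* The improper cases [set0] and [setT] are allowed. *)
Definition prime_filter F : bool :=
  [forall x, forall y, ((x `&` y \in F) == (x \in F) && (y \in F)) &&
                       ((x `|` y \in F) == (x \in F) || (y \in F))].

Lemma prime_filterP F :
  reflect ((forall x y, (x `&` y \in F) = (x \in F) && (y \in F)) /\
           (forall x y, (x `|` y \in F) = (x \in F) || (y \in F)))
          (prime_filter F).
Proof.
apply: (iffP idP) => [pF|[FI FU]]; last first.
  by apply/forallP => x; apply/forallP => y; rewrite FI FU !eqxx.
by split=> x y; have /forallP/(_ y)/andP[/eqP ? /eqP ?] := forallP pF x.
Qed.

Lemma prime_filter0 : prime_filter set0.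
Proof. by apply/prime_filterP; split=> x y; rewrite !inE. Qed.

Lemma prime_filterT : prime_filter setT.
Proof. by apply/prime_filterP; split=> x y; rewrite !inE. Qed.

(** If [x <= y] fails, the principal filter of a join-prime element below [x] but not below [y]
    separates them. *)
Lemma prime_filter_sep x y :
  (forall F, prime_filter F -> x \in F -> y \in F) -> x <= y.
Proof.
move=> sep; case: (boolP (x <= y)) => // nle_xy.
pose P := [pred t | (t <= x) && ~~ (t <= y)].
have Px : P x by rewrite /= lexx.
(* A minimal [j] below [x] but not below [y] is join-prime. *)
case: (@arg_minnP _ x P (fun t => #|[set s | s <= t]|) Px) => j /andP[le_jx nle_jy] minj.
have ltP t : t <= j -> (t == j) || (t <= y).
  move=> le_tj; case: eqVneq => //= neq_tj; apply: contraT => nle_ty.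
  have /minj : P t by rewrite /= nle_ty (le_trans le_tj).
  rewrite leqNgt => /negP[]; apply: proper_card; apply/properP; split.
    by apply/subsetP => s; rewrite !inE => /le_trans; apply.
  exists j; rewrite !inE ?lexx //.
  by apply: contra neq_tj => le_jt; rewrite eq_le le_tj.
have: y \in [set t | j <= t]; last by rewrite inE (negPf nle_jy).
apply: sep; last by rewrite inE.
apply/prime_filterP; split=> u v; rewrite !inE ?lexI //.
apply/idP/orP => [le_juv|[] le_j]; last 2 first.
- exact: le_trans le_j (leUl _ _).
- exact: le_trans le_j (leUr _ _).
(* Distributivity splits [j]; were both parts different from [j], both would lie below [y], and so
   would [j]. *)
have defj : (j `&` u) `|` (j `&` v) = j by rewrite -meetUr; apply/meet_idPl.
case/orP: (ltP _ (leIl j u)) => [/eqP/meet_idPl|leu]; first by left.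
case/orP: (ltP _ (leIl j v)) => [/eqP/meet_idPl|lev]; first by right.
by case/negP: nle_jy; rewrite -defj leUx leu.
Qed.

End PrimeFilters.

(** The separating family on [T *p T] consists of the prime filters pulled back along either
    coordinate. *)
Lemma adjacent_from_filters (disp : Order.disp_t) (T : finDistrLatticeType disp)
    (e : rel T) (x y : T) :
  reflexive e -> symmetric e -> compatible e ->
  (forall F H : {set T}, prime_filter F -> prime_filter H -> H \subset F ->
     (x \in H) && (y \notin F) || (y \in H) && (x \notin F) ->
     exists a b, [/\ e a b, a \in H & b \notin F]) ->
  e x y.
Proof.
move=> e_refl e_sym e_compat edges.
pose I := (bool * {F : {set T} | prime_filter F})%type.
pose F (i : I) : {pred (T *p T)} :=
  [pred p : T *p T | (if i.1 then p.1 else p.2) \in val i.2].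
pose S : {pred (T *p T)} := [pred p : T *p T | e p.1 p.2].
(* Filters on different coordinates: the loop at [u] serves if [v \in K], a loop at a vertex of [H]
   outside [K] if there is one, and otherwise [edges] applies to [H \subset K]. *)
have edge_or_refl u v (H K : {set T}) : prime_filter H -> prime_filter K ->
    (u = x /\ v = y) \/ (u = y /\ v = x) ->
    u \in H -> exists a b, [/\ e a b, a \in H & b \in K -> v \in K].
  move=> pH pK uv uH; case: (boolP (v \in K)) => vK; first by exists u, u.
  case: (boolP (H \subset K)) => [sHK|/subsetPn[a aH aK]].
    have [|a [b [eab aH bK]]] := edges K H pK pH sHK.
      by case: uv => -[<- <-]; rewrite uH vK ?orbT.
    by exists a, b; split=> //; move/negP: bK.
  by exists a, a; split=> //; move/negP: aK.
apply: (@sublattice_interpolation _ (T *p T) I F S (x, y)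
          (true, exist _ setT prime_filterT)) => //=.
- move=> [b [H pH]] [x1 x2] [y1 y2]; have [HI _] := prime_filterP _ pH.
  by case: b; rewrite !inE /= HI.
- move=> [x1 x2] [y1 y2] sep; rewrite leEprod /=; apply/andP; split;
    apply: prime_filter_sep => H pH.
    exact: (sep (true, exist _ H pH)).
  exact: (sep (false, exist _ H pH)).
- by move=> [x1 x2] [y1 y2]; rewrite !inE /= => ex ey; have [] := e_compat _ _ _ _ ex ey.
- by move=> [x1 x2] [y1 y2]; rewrite !inE /= => ex ey; have [] := e_compat _ _ _ _ ex ey.
- by rewrite !inE.
move=> [b [H pH]] [c [K pK]]; case: b; case: c; rewrite !inE /= => zH.
(* Both filters constrain the same coordinate, so a loop suffices. *)
- by exists (x, x); split; rewrite ?inE.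
- have [a [b [eab aH bK]]] :=
    edge_or_refl x y H K pH pK (or_introl (conj erefl erefl)) zH.
  by exists (a, b); rewrite !inE.
- have [a [b [eab aH bK]]] :=
    edge_or_refl y x H K pH pK (or_intror (conj erefl erefl)) zH.
  by exists (b, a); rewrite !inE /= e_sym.
- by exists (y, y); split; rewrite ?inE.
Qed.

Section ChainProducts.
Local Open Scope order_scope.
Context {d : nat} {n : 'I_d -> nat}.

(* [i0] only witnesses that [d > 0]. *)
Lemma complement_sublattice_vertex_intervals (S : {set chain_prod n}) (i0 : 'I_d) :
  sublattice S -> union_of_vertex_intervals (~: S).
Proof.
move=> [SI SU].
pose interval (p : {i : 'I_d & 'I_(n i).+1} * {j : 'I_d & 'I_(n j).+1}) :=
  vertex_interval (tagged p.1) (tagged p.2).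
exists [set interval p | p in [pred p | [disjoint interval p & S]]].
  move=> A /imsetP[[[i alpha] [j beta]] _ ->].
  by exists i, j, alpha, beta.
apply/setP => z; apply/idP/bigcupP => [zS|[A /imsetP[p dis ->] zA]]; last first.
  by rewrite inE; apply: contraTN zA => zS; rewrite (disjointFl dis zS).
case: (pickP [pred p | [disjoint interval p & S] & z \in interval p]).
  by move=> p /andP[dis zp]; exists (interval p) => //; apply: imset_f.
move=> no_interval; move: zS; rewrite inE => /negP[].
pose F (i : {i : 'I_d & 'I_(n i).+1}) : {pred chain_prod n} :=
  [pred x : chain_prod n | tagged i <= x (tag i)].
apply: (@sublattice_interpolation _ (chain_prod n) _ F (mem S) z (Tagged _ (z i0))) => //.
- by move=> i x y; rewrite !inE /= ffunE lexI.
- move=> x y sep; apply/forallP => i.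
  by apply: (sep (Tagged _ (x i))); rewrite inE.
- by rewrite inE /=.
move=> [i alpha] [j beta]; rewrite !inE /= => le_alpha.
(* The interval bounded by the coordinates of [z] itself contains [z], hence meets [S]; any common
   element interpolates. *)
have := no_interval (Tagged _ (z i), Tagged _ (z j)).
rewrite /= /interval /vertex_interval inE /= !lexx !andbT.
case/negbT/pred0Pn => s /=; rewrite inE => /andP[/andP[les sle] Ss].
exists s; split=> //; rewrite inE /=; first exact: le_trans les.
by move=> /le_trans; apply.
Qed.

End ChainProducts.

Definition three_chain_graph (complete : bool) : rel 'I_3 :=
  fun a b => complete || (a <= b.+1)%N && (b <= a.+1)%N.

Lemma three_chain_graph_interval c : proper_interval_graph (three_chain_graph c).
Proof.
rewrite /three_chain_graph; split.
- by move=> a; rewrite leqnSn orbT.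
- by move=> a b; rewrite andbC.
by move=> a b b' a'; rewrite !leEord; case: c => //=; lia.
Qed.

Lemma three_chain_graph_compatible c : compatible (three_chain_graph c).
Proof.
rewrite /three_chain_graph => a a' b b'; case: c => //=.
by case: (leP a b); case: (leP a' b'); rewrite ?leEord ?ltEord; lia.
Qed.

Theorem theorem5p1 (disp : Order.disp_t) (T : finDistrLatticeType disp)
    (e : rel T) (e_refl : reflexive e) (e_sym : symmetric e)
    (e_compat : compatible e) :
  exists (d : nat) (n : 'I_d -> nat) (V : {set chain_prod n})
         (phi : T -> chain_prod n) (G : forall i : 'I_d, rel 'I_(n i).+1),
    0 < d /\
    union_of_vertex_intervals V /\
    sublattice (~: V) /\
    lattice_iso_onto phi (~: V) /\
    (forall i : 'I_d, proper_interval_graph (G i) /\ compatible (G i)) /\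
    graph_iso_onto_induced e (cat_prod G) phi (~: V).
Proof.
pose nested (p : {set T} * {set T}) :=
  [&& prime_filter p.1, prime_filter p.2 & p.2 \subset p.1].
pose I : finType := {p | nested p}.
(* The sum is at most 2, so the default value of [inord] never occurs. *)
pose level (p : {set T} * {set T}) x : 'I_3 := inord ((x \in p.1) + (x \in p.2)).
pose joined (p : {set T} * {set T}) :=
  [exists a in p.2, exists b, (b \notin p.1) && e a b].
pose n (i : 'I_#|I|) := 2.
pose pair_at (i : 'I_#|I|) : {set T} * {set T} := val (enum_val i).
pose phi x : chain_prod n := [ffun i => level (pair_at i) x].
pose G (i : 'I_#|I|) : rel 'I_(n i).+1 := three_chain_graph (joined (pair_at i)).
have levelE p x : level p x = (x \in p.1) + (x \in p.2) :> nat.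
  by rewrite inordK //; case: (_ \in _); case: (_ \in _).
have pair_atK p : nested p -> exists i, pair_at i = p.
  by move=> np; exists (enum_rank (Sub p np : I)); rewrite /pair_at enum_rankK.
have pair_atP i : nested (pair_at i) := valP (enum_val i).
have I_gt0 : 0 < #|I|.
  have n0 : nested (set0, set0) by rewrite /nested prime_filter0 subxx.
  by apply/card_gt0P; exists (Sub (set0, set0) n0).
(* Since one filter contains the other, the possible membership patterns form a chain, and the sum
   respects meets and joins. *)
have phiI : Order.meet_morphism phi.
  move=> x y; apply/ffunP => i; rewrite !ffunE; apply/ord_inj.
  have /and3P[/prime_filterP[FI _] /prime_filterP[HI _] /subsetP sHF] := pair_atP i.
  rewrite levelE FI HI; move: (sHF x) (sHF y).
  by case: (leP (level _ x)); rewrite ?leEord ?ltEord !levelE;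
    do 4!case: (_ \in _) => //; move=> // *; exfalso; auto.
have phiU : Order.join_morphism phi.
  move=> x y; apply/ffunP => i; rewrite !ffunE; apply/ord_inj.
  have /and3P[/prime_filterP[_ FU] /prime_filterP[_ HU] /subsetP sHF] := pair_atP i.
  rewrite levelE FU HU; move: (sHF x) (sHF y).
  by case: (leP (level _ x)); rewrite ?leEord ?ltEord !levelE;
    do 4!case: (_ \in _) => //; move=> // *; exfalso; auto.
have phi_inj : injective phi.
  move=> x y eq_phi; have sep F : prime_filter F -> (x \in F) = (y \in F).
    (* The repeated pair [(F, F)] yields only the levels 0 and 2, so the level determines membership
       in [F]. *)
    move=> pF; have [|i def_i] := pair_atK (F, F); first by rewrite /nested pF subxx.
    have /(congr1 (@nat_of_ord _)) := congr1 (fun f : chain_prod n => f i) eq_phi.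
    by rewrite !ffunE !levelE def_i /=; do 2!case: (_ \in _).
  by apply: le_anti; apply/andP; split; apply: prime_filter_sep => F /sep ->.
pose S := [set phi x | x : T].
have phi_bij : bij_onto phi (~: ~: S) by rewrite setCK.
have S_sub : sublattice S.
  split=> _ _ /imsetP[x _ ->] /imsetP[y _ ->].
    by rewrite -phiI imset_f.
  by rewrite -phiU imset_f.
exists #|I|, n, (~: S), phi, G; split=> //; split; [|split; [|split; [|split]]].
- exact: complement_sublattice_vertex_intervals (Ordinal I_gt0) S_sub.
- by rewrite setCK.
- by split.
- by split; [apply: three_chain_graph_interval | apply: three_chain_graph_compatible].
split=> // x y; apply/forallP/idP => [adj|exy i]; last first.
  (* Only the levels 0 and 2 of a path are non-adjacent; an edge with these levels would make the
     pair [joined]. *)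
  rewrite /G /three_chain_graph !ffunE !levelE.
  case: (boolP (joined _)) => //= /exists_inPn no_edge.
  have nedge a b : e a b -> a \in (pair_at i).2 -> b \in (pair_at i).1.
    move=> eab /no_edge/existsPn/(_ b); rewrite eab andbT; exact: negbNE.
  have eyx : e y x by rewrite e_sym.
  move: (nedge x y exy) (nedge y x eyx).
  by do 4!case: (_ \in _) => //=; move=> // *; exfalso; auto.
apply: adjacent_from_filters => // F H pF pH sHF sep.
have [|i def_i] := pair_atK (F, H); first by rewrite /nested pF pH sHF.
have := adj i; rewrite /G /three_chain_graph !ffunE !levelE def_i /=.
(* Either [joined] supplies the edge, or the levels differ by at most 1, whereas [sep] makes them 2
   and 0. *)
case/orP => [/exists_inP[a aH /existsP[b /andP[bF eab]]]|]; first by exists a, b.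
have := subsetP sHF x; have := subsetP sHF y; move: sep.
by do 4!case: (_ \in _) => //=; move=> // *; exfalso; auto.
Qed.
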